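(* Let $U=(u_{i,j})$ be a real $N\times M$ matrix such that the zero-sum bilinear game with payoff matrix $U$ has a fully mixed Nash equilibrium $(p,q)$, and let all $f_i$ ($1\le i\le N$) and $g_j$ ($1\le j\le M$) be the sigmoid function $\sigma:\mathbb{R}\to\mathbb{R}$, $\sigma(x)=(1+e^{-x})^{-1}$. For a learning rate $\alpha>0$ consider the discrete-time gradient-descent-ascent iteration $$\theta_i^{k+1}=\theta_i^k-\alpha\,\sigma'(\theta_i^k)\Big(\sum_{j=1}^M u_{i,j}\sigma(\phi_j^k)+\lambda^k\Big),\qquad \phi_j^{k+1}=\phi_j^k+\alpha\,\sigma'(\phi_j^k)\Big(\sum_{i=1}^N u_{i,j}\sigma(\theta_i^k)+\mu^k\Big),$$ $$\mu^{k+1}=\mu^k-\alpha\Big(\sum_{j=1}^M\sigma(\phi_j^k)-1\Big),\qquad \lambda^{k+1}=\lambda^k+\alpha\Big(\sum_{i=1}^N\sigma(\theta_i^k)-1\Big).$$ Then for every safe initialization $(\theta^0,\phi^0,\lambda^0,\mu^0)$ the function $$H=\sum_{i=1}^N\int_{p_i}^{\sigma(\theta_i)}\frac{z-p_i}{|\sigma'(\sigma^{-1}(z))|^2}\,dz+\sum_{j=1}^M\int_{q_j}^{\sigma(\phi_j)}\frac{z-q_j}{|\sigma'(\sigma^{-1}(z))|^2}\,dz+\int_{\lambda^*}^{\lambda}(z-\lambda^* )\,dz+\int_{\mu^*}^{\mu}(z-\mu^* )\,dz$$ is non-decreasing along the iteration, i.e. its value at $(\theta^{k+1},\phi^{k+1},\lambda^{k+1},\mu^{k+1})$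 is at least its value at $(\theta^{k},\phi^{k},\lambda^{k},\mu^{k})$ for all $k\ge0$.
   Context: Here $\theta\in\mathbb{R}^N$, $\phi\in\mathbb{R}^M$, $\lambda,\mu\in\mathbb{R}$. The iteration is the Euler discretization (step $\alpha$) of continuous-time gradient-descent-ascent for $\min_{\theta,\mu}\max_{\phi,\lambda}\ \sum_{i,j}u_{i,j}\sigma(\theta_i)\sigma(\phi_j)+\lambda(\sum_i\sigma(\theta_i)-1)+\mu(\sum_j\sigma(\phi_j)-1)$. A fully mixed Nash equilibrium $(p,q)$ of the game $U$ is a pair of probability vectors $p\in\mathbb{R}^N$, $q\in\mathbb{R}^M$ with all entries strictly positive such that $p$ minimizes $x\mapsto x^\top Uq$ over probability vectors $x$ and $q$ maximizes $y\mapsto p^\top Uy$ over probability vectors $y$. $\lambda^*,\mu^*$ are the real numbers determined by $\sum_{j}u_{i,j}q_j+\lambda^*=0$ for all $i$ and $\sum_i u_{i,j}p_i+\mu^*=0$ for all $j$. With these, $H$ is the conserved quantity of the continuous-time dynamics. Safe initialization: for all $i,j$, $\theta_i^0$ and $\phi_j^0$ are not stationary points of $\sigma$, and $p_i$ (resp. $q_j$) belongs to the set of values attained by $\sigma$ along the full (all times in $\mathbb{R}$) gradient ascent trajectory $\dot x=\sigma'(x)$ starting at $\theta_i^0$ (resp. $\phi_j^0$); for the sigmoid this set of values is $(0,1)$. *)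

(* Defs.v *)
From HB Require Import structures.
From mathcomp Require Import all_boot all_order all_algebra.
From mathcomp Require Import all_classical all_reals all_analysis.

Set Implicit Arguments.
Unset Strict Implicit.
Unset Printing Implicit Defensive.

Import Order.TTheory GRing.Theory Num.Theory.
Import numFieldNormedType.Exports.

Local Open Scope classical_set_scope.
Local Open Scope ring_scope.

Definition sigmoid {R : realType} (x : R) : R := (1 + expR (- x))^-1.

(* Only the values of the partial inverse on the range ]0, 1[ of [sigmoid]
   are meaningful. *)
Definition sigmoid_inv {R : realType} : R -> R := pinv [set: R] sigmoid.

(* Integral from a to b in the oriented sense, so that swapping the bounds
   changes the sign. *)
Definition oriented_integral {R : realType} (a b : R) (f : R -> R) : R :=
  if a <= b then \int[lebesgue_measure]_(z in `[a, b]) f z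
  else - \int[lebesgue_measure]_(z in `[b, a]) f z.

Definition prob_vector {R : realType} {n : nat} (x : 'cV[R]_n) : Prop :=
  (forall i, 0 <= x i 0) /\ \sum_(i < n) x i 0 = 1.

(* x^T U y, which the row player minimizes and the column player maximizes *)
Definition payoff {R : realType} {N M : nat} (U : 'M[R]_(N, M))
    (x : 'cV[R]_N) (y : 'cV[R]_M) : R :=
  (x^T *m U *m y) 0 0.

Definition fully_mixed_nash {R : realType} {N M : nat} (U : 'M[R]_(N, M))
    (p : 'cV[R]_N) (q : 'cV[R]_M) : Prop :=
  [/\ prob_vector p /\ prob_vector q,
      (forall i, 0 < p i 0) /\ (forall j, 0 < q j 0),
      (forall x, prob_vector x -> payoff U p q <= payoff U x q) &
      (forall y, prob_vector y -> payoff U p y <= payoff U p q)].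

(* At a fully mixed equilibrium (p, q) each of the two systems below has
   exactly one solution; the default value 0 of [xget] is then irrelevant. *)
Definition lambda_star {R : realType} {N M : nat} (U : 'M[R]_(N, M))
    (q : 'cV[R]_M) : R :=
  xget 0 [set l | forall i, \sum_(j < M) U i j * q j 0 + l = 0].

Definition mu_star {R : realType} {N M : nat} (U : 'M[R]_(N, M))
    (p : 'cV[R]_N) : R :=
  xget 0 [set m | forall j, \sum_(i < N) U i j * p i 0 + m = 0].

Record state (R : realType) (N M : nat) := State {
  theta : 'cV[R]_N;
  phi : 'cV[R]_M;
  lambda : R;
  mu : R }.

Definition gda_step {R : realType} {N M : nat} (U : 'M[R]_(N, M)) (alpha : R)
    (s : state R N M) : state R N M :=
  State
    (\col_(i < N) (theta s i 0 - alpha * derive1 sigmoid (theta s i 0) *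
       (\sum_(j < M) U i j * sigmoid (phi s j 0) + lambda s)))
    (\col_(j < M) (phi s j 0 + alpha * derive1 sigmoid (phi s j 0) *
       (\sum_(i < N) U i j * sigmoid (theta s i 0) + mu s)))
    (lambda s + alpha * (\sum_(i < N) sigmoid (theta s i 0) - 1))
    (mu s - alpha * (\sum_(j < M) sigmoid (phi s j 0) - 1)).

Definition gradient_ascent_trajectory {R : realType} (f : R -> R) (x0 : R)
    (x : R -> R) : Prop :=
  x 0 = x0 /\ forall t : R, is_derive t (1 : R) x (derive1 f (x t)).

(* The values of f along the trajectory through x0, over all times in R. *)
Definition trajectory_values {R : realType} (f : R -> R) (x0 : R) : set R :=
  [set z | exists x : R -> R,
     gradient_ascent_trajectory f x0 x /\ exists t : R, f (x t) = z].

Definition safe_for {R : realType} (f : R -> R) (x0 z : R) : Prop :=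
  derive1 f x0 != 0 /\ trajectory_values f x0 z.

Definition safe {R : realType} {N M : nat} (p : 'cV[R]_N) (q : 'cV[R]_M)
    (s : state R N M) : Prop :=
  (forall i, safe_for sigmoid (theta s i 0) (p i 0)) /\
  (forall j, safe_for sigmoid (phi s j 0) (q j 0)).

Definition sigmoid_energy {R : realType} (a x : R) : R :=
  oriented_integral a (sigmoid x)
    (fun z => (z - a) / `|derive1 sigmoid (sigmoid_inv z)| ^+ 2).

Definition H {R : realType} {N M : nat} (U : 'M[R]_(N, M))
    (p : 'cV[R]_N) (q : 'cV[R]_M) (s : state R N M) : R :=
  \sum_(i < N) sigmoid_energy (p i 0) (theta s i 0) +
  \sum_(j < M) sigmoid_energy (q j 0) (phi s j 0) +
  oriented_integral (lambda_star U q) (lambda s)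
    (fun z => z - lambda_star U q) +
  oriented_integral (mu_star U p) (mu s) (fun z => z - mu_star U p).

(* Main.v *)
Require Import Defs.
From mathcomp Require Import all_boot all_order all_algebra.
From mathcomp Require Import all_classical all_reals all_analysis.
From mathcomp Require Import ring lra.

Set Implicit Arguments.
Unset Strict Implicit.
Unset Printing Implicit Defensive.

Import Order.TTheory GRing.Theory Num.Theory.
Import numFieldNormedType.Exports.

Local Open Scope ring_scope.

(** In the unconstrained coordinates [x = theta i], resp. [x = phi j], the
    summand of [H] attached to an equilibrium weight [p] is, up to an additive
    constant,

      (1 - 2 p) x + (1 - p) e^x + p e^(- x),

    because sigma' = sigma (1 - sigma) makes the integrand rational. It is
    therefore convex when 0 < p < 1, with derivative (sigma x - p) / sigma' x
    ([sigmoid_energyE], [sigmoid_energy_step]). The other two summands of [H]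
    are halved squares ([oriented_integral_subr]), so [H] is convex in
    (theta, phi, lambda, mu).

    Along one iteration [H] thus grows by at least its first-order variation,
    and that variation is zero: the factor sigma' in the update cancels the
    denominator of the derivative, and after recentring the payoffs at the
    equilibrium ([interaction_centered]) the bilinear terms of the two players
    are opposite, as are the constraint terms and the variations in lambda and
    mu. This is the computation which shows that continuous-time dynamics
    conserve [H]; a convex conserved quantity can only grow under the explicit
    Euler scheme.

    The multipliers lambda* and mu* exist because all entries of a mixed
    equilibrium are positive: each pure strategy is then a best response
    ([lambda_starP], [mu_starP]). A safe initialization forces the equilibrium
    weights to be values of sigma, hence in ]0, 1[. *)

(** * Oriented integrals by antiderivatives *)

Section OrientedIntegral.
Variable R : realType.
Implicit Types (f F : R -> R) (i : interval R) (a b x : R).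

Lemma Rintegral_FTC f F a b : a <= b ->
  {in `[a, b], forall x, is_derive x 1 F (f x)} ->
  {in `[a, b], forall x, derivable f x 1} ->
  (\int[lebesgue_measure]_(z in `[a, b]) f z)%R = F b - F a.
Proof.
rewrite le_eqVlt => /predU1P[<-|ab] dF df.
  by rewrite set_itv1 Rintegral_set1 subrr.
have cF x : x \in `[a, b] -> {for x, continuous F}.
  move=> /dF dFx; apply: differentiable_continuous.
  by apply/derivable1_diffP; exact: ex_derive.
have sub x : x \in `]a, b[ -> x \in `[a, b] by exact: subset_itv_oo_cc.
have aI : a \in `[a, b] by rewrite in_itv/= lexx ltW.
have bI : b \in `[a, b] by rewrite in_itv/= lexx ltW.
rewrite /Rintegral (@continuous_FTC2 _ f F a b)//.
- exact: derivable_within_continuous.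
- split; [|exact/cvg_at_right_filter/cF|exact/cvg_at_left_filter/cF].
  by move=> x /sub /dF dFx; exact: ex_derive.
- by move=> x /sub /dF dFx; rewrite derive1E derive_val.
Qed.

(** Taking the hypotheses on an interval [i] that contains both bounds treats
    the two orientations at once. The function [g] stands for a closed form of
    [f] that is valid on [i] only, as happens for [sigmoid_inv]. *)
Lemma oriented_integral_FTC f g F i a b : a \in i -> b \in i ->
  {in i, f =1 g} -> {in i, forall x, is_derive x 1 F (g x)} ->
  {in i, forall x, derivable g x 1} ->
  oriented_integral a b f = F b - F a.
Proof.
move=> ai bi fg dF dg; rewrite /oriented_integral.
have sub x y z : x \in i -> y \in i -> z \in `[x, y] -> z \in i.
  move=> xi yi; rewrite in_itv/= => xzy.
  exact: (interval_is_interval xi yi).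
have FTC x y : x \in i -> y \in i -> x <= y ->
    (\int[lebesgue_measure]_(z in `[x, y]) f z)%R = F y - F x.
  move=> xi yi xy.
  have -> : (\int[lebesgue_measure]_(z in `[x, y]) f z =
             \int[lebesgue_measure]_(z in `[x, y]) g z)%R.
    by apply: eq_Rintegral => z; rewrite inE/= => /(sub _ _ _ xi yi) /fg.
  by apply: Rintegral_FTC => // z /(sub _ _ _ xi yi) zi; [exact: dF|exact: dg].
case: (leP a b) => [ab|/ltW ba]; first exact: FTC.
by rewrite FTC// opprB.
Qed.

Lemma oriented_integral_subr a b :
  oriented_integral a b (fun z => z - a) = (b - a) ^+ 2 / 2.
Proof.
rewrite (@oriented_integral_FTC _ (fun z => z - a)
  (fun z => (z - a) ^+ 2 / 2) `]-oo, +oo[)//.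
- by rewrite subrr expr0n/= mul0r subr0.
- move=> x _.
  have -> : (fun z : R => (z - a) ^+ 2 / 2) =
    (fun z => 2^-1 *: (z - a) ^+ 2) by apply/funext => z; rewrite mulrC.
  by apply: is_derive_eq; rewrite /GRing.scale/=; field.
Qed.

End OrientedIntegral.

(** * The energy of one sigmoid coordinate *)

Section Sigmoid.
Variable R : realType.
Implicit Types p x y z t : R.

Lemma sigmoid_denom_gt0 x : 0 < 1 + expR (- x).
Proof. by rewrite addr_gt0 ?expR_gt0. Qed.

Lemma sigmoid_gt0 x : 0 < sigmoid x.
Proof. by rewrite invr_gt0 sigmoid_denom_gt0. Qed.

Lemma sigmoid_lt1 x : sigmoid x < 1.
Proof. by rewrite invf_lt1 ?sigmoid_denom_gt0// ltrDl expR_gt0. Qed.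

Lemma derive1_sigmoid x : derive1 sigmoid x = sigmoid x * (1 - sigmoid x).
Proof.
have d0 : 1 + expR (- x) != 0 by rewrite gt_eqF ?sigmoid_denom_gt0.
have dE : is_derive x 1 (fun y : R => 1 + expR (- y)) (- expR (- x)).
  have dN : is_derive x 1 (fun y : R => - y) (-1) by exact: is_deriveN.
  have := is_derive1_comp (is_derive_expR (- x)) dN.
  rewrite mulrN1 => dEN.
  have -> : (fun y : R => 1 + expR (- y)) = cst 1 + (expR \o -%R).
    by apply/funext.
  by apply: is_derive_eq; rewrite add0r.
have dS : is_derive x 1 (@sigmoid R) (- (1 + expR (- x)) ^- 2 *: - expR (- x)).
  exact: is_deriveV.
rewrite derive1E derive_val /sigmoid /GRing.scale/=.
by field.
Qed.

Lemma sigmoidV x : (sigmoid x)^-1 = 1 + expR (- x).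
Proof. exact: invrK. Qed.

Lemma onem_sigmoidV x : (1 - sigmoid x)^-1 = 1 + expR x.
Proof.
have := expR_gt0 x; have := sigmoid_denom_gt0 x; rewrite /sigmoid expRN => dx ex.
by field; rewrite addrAC subrr add0r oner_eq0 !gt_eqF ?addr_gt0.
Qed.

Lemma sigmoid_logit z : z \in `]0, 1[ -> sigmoid (ln z - ln (1 - z)) = z.
Proof.
rewrite in_itv/= => /andP[z0 z1].
rewrite /sigmoid opprB expRD expRN !lnK ?posrE ?subr_gt0//.
by field; rewrite addrC subrK oner_eq0 gt_eqF.
Qed.

Lemma logit_sigmoid x : ln (sigmoid x) - ln (1 - sigmoid x) = x.
Proof.
have s0 := sigmoid_gt0 x; have s1 := sigmoid_lt1 x.
rewrite -ln_div ?posrE ?subr_gt0// -[RHS]expRK; congr ln.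
have -> : expR x = (1 - sigmoid x)^-1 - 1 by rewrite onem_sigmoidV addrC addKr.
by field; rewrite gt_eqF ?subr_gt0.
Qed.

Lemma sigmoid_invK z : z \in `]0, 1[ -> sigmoid (sigmoid_inv z) = z.
Proof.
move=> zI; rewrite /sigmoid_inv pinvK// inE.
by exists (ln z - ln (1 - z)) => //; exact: sigmoid_logit.
Qed.

(** The integrand of [sigmoid_energy] on ]0, 1[, where the derivative of sigma
    at the preimage of z is z (1 - z). *)
Definition energy_weight p z := (z - p) / (z * (1 - z)) ^+ 2.

(** The partial fraction decomposition of [energy_weight p] gives this
    antiderivative on ]0, 1[. *)
Definition energy_potential p z :=
  (1 - 2 * p) * (ln z - ln (1 - z)) + (1 - p) * (1 - z)^-1 + p * z^-1.

Lemma is_derive_energy_potential p z : z \in `]0, 1[ ->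
  is_derive z 1 (energy_potential p) (energy_weight p z).
Proof.
rewrite in_itv/= => /andP[z0 z1].
have z'0 : 0 < 1 - z by rewrite subr_gt0.
have dB : is_derive z 1 (fun y : R => 1 - y) (-1).
  by apply: is_derive_eq; rewrite add0r mul1r.
have dln := is_derive1_ln z0.
have dlnB : is_derive z 1 (@ln R \o (fun y : R => 1 - y)) ((1 - z)^-1 * -1).
  by apply: is_derive1_comp; exact: is_derive1_ln.
have dV : is_derive z 1 (fun y : R => y^-1) (- z ^- 2 *: 1).
  by apply: is_deriveV; rewrite gt_eqF.
have dBV : is_derive z 1 (fun y : R => (1 - y)^-1) (- (1 - z) ^- 2 *: -1).
  by apply: is_deriveV; rewrite gt_eqF.
have -> : energy_potential p =
  (1 - 2 * p) \*: (@ln R - (@ln R \o (fun y : R => 1 - y)))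
  + (1 - p) \*: (fun y : R => (1 - y)^-1) + p \*: (fun y : R => y^-1).
  by apply/funext.
apply: is_derive_eq; rewrite /energy_weight /GRing.scale/=.
by field; rewrite !gt_eqF.
Qed.

Lemma derivable_energy_weight p z : z \in `]0, 1[ ->
  derivable (energy_weight p) z 1.
Proof.
rewrite in_itv/= => /andP[z0 z1].
have d0 : z * (1 - z) != 0 by rewrite mulf_neq0// gt_eqF ?subr_gt0.
pose f : R -> R := (id * (cst 1 - id)) ^+ 2.
have -> : energy_weight p = (id - cst p) * (fun y => (f y)^-1).
  by apply/funext => y; rewrite /energy_weight /f !fctE.
apply: derivableM; first exact: derivableB.
apply: derivableV; first by rewrite /f !fctE expf_neq0.
by apply: derivableX; apply: derivableM => //; exact: derivableB.
Qed.

(** The change of variable z = sigma x turns ln z - ln (1 - z) into x, and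
    1 / (1 - z), 1 / z into 1 + e^x, 1 + e^(- x): the energy becomes an
    affine function plus (1 - p) e^x + p e^(- x), whose convexity is visible. *)
Lemma sigmoid_energyE p x : p \in `]0, 1[ ->
  sigmoid_energy p x =
  (1 - 2 * p) * x + (1 - p) * (1 + expR x) + p * (1 + expR (- x))
  - energy_potential p p.
Proof.
move=> pI; rewrite /sigmoid_energy.
rewrite (@oriented_integral_FTC _ _ (energy_weight p)
  (energy_potential p) `]0, 1[).
- by rewrite {1}/energy_potential logit_sigmoid onem_sigmoidV sigmoidV.
- exact: pI.
- by rewrite in_itv/= sigmoid_gt0 sigmoid_lt1.
- move=> z zI; rewrite /energy_weight derive1_sigmoid sigmoid_invK//.
  by rewrite real_normK// num_real.
- by move=> z zI; exact: is_derive_energy_potential.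
- by move=> z zI; exact: derivable_energy_weight.
Qed.

(** The tangent inequality of a convex function. The displacement carries the
    factor sigma' x, as in the gradient updates, which removes the denominator
    of the derivative (sigma x - p) / sigma' x. *)
Lemma sigmoid_energy_step p x t : p \in `]0, 1[ ->
  sigmoid_energy p x + (sigmoid x - p) * t
  <= sigmoid_energy p (x + derive1 sigmoid x * t).
Proof.
move=> pI; rewrite !sigmoid_energyE//.
move: (pI); rewrite in_itv/= => /andP[p0 p1].
set h := derive1 sigmoid x * t.
have -> : (sigmoid x - p) * t =
    ((1 - 2 * p) + (1 - p) * expR x - p * expR (- x)) * h.
  have -> : expR x = (1 - sigmoid x)^-1 - 1 by rewrite onem_sigmoidV addrC addKr.
  have -> : expR (- x) = (sigmoid x)^-1 - 1 by rewrite sigmoidV addrC addKr.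
  have := sigmoid_gt0 x; have := sigmoid_lt1 x => s1 s0.
  by rewrite /h derive1_sigmoid; field; rewrite !gt_eqF ?subr_gt0.
have tangent y k : expR y + expR y * k <= expR (y + k).
  by rewrite expRD -[X in X + _]mulr1 -mulrDr ler_pM2l ?expR_gt0// expR_ge1Dx.
have p1' : 0 <= 1 - p by rewrite subr_ge0 ltW.
have := ler_wpM2l p1' (tangent x h).
have := ler_wpM2l (ltW p0) (tangent (- x) (- h)).
rewrite -opprD; lra.
Qed.

End Sigmoid.

(** * Indifference at a fully mixed equilibrium *)

Section Game.
Variable R : realType.

(** The deviations from the mean are nonnegative with zero weighted sum. *)
Lemma mean_le_all_eq n (w c : 'I_n -> R) : (forall i, 0 < w i) ->
  \sum_i w i = 1 -> (forall i, \sum_k w k * c k <= c i) ->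
  forall i, c i = \sum_k w k * c k.
Proof.
move=> w0 w1; set m := \sum_k _ => mc i.
have : \sum_k w k * (c k - m) == 0.
  under eq_bigr do rewrite mulrBr.
  by rewrite sumrB -mulr_suml w1 mul1r subrr.
rewrite psumr_eq0 => [/allP/(_ i)|k _]; last first.
  by rewrite mulr_ge0 ?subr_ge0// ltW.
rewrite mem_index_enum mulf_eq0 gt_eqF//= subr_eq0.
by move=> /(_ isT)/eqP.
Qed.

Lemma payoff_rows N M (U : 'M[R]_(N, M)) x y :
  payoff U x y = \sum_i x i 0 * \sum_j U i j * y j 0.
Proof.
rewrite /payoff -mulmxA mxE; apply: eq_bigr => i _.
by rewrite !mxE.
Qed.

Lemma payoff_cols N M (U : 'M[R]_(N, M)) x y :
  payoff U x y = \sum_j y j 0 * \sum_i U i j * x i 0.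
Proof.
rewrite /payoff mxE; apply: eq_bigr => j _.
rewrite mxE mulrC; congr (_ * _); apply: eq_bigr => i _.
by rewrite mxE mulrC.
Qed.

Lemma prob_vector_delta n (i : 'I_n) : prob_vector (delta_mx i 0 : 'cV[R]_n).
Proof.
split=> [k|]; first by rewrite mxE ler0n.
rewrite (bigD1 i)//= big1 ?mxE ?eqxx ?addr0// => k /negPf ki.
by rewrite mxE ki.
Qed.

Lemma sum_delta n (i : 'I_n) (c : 'I_n -> R) :
  \sum_k (delta_mx i 0 : 'cV[R]_n) k 0 * c k = c i.
Proof.
rewrite (bigD1 i)//= big1 ?mxE ?eqxx ?mul1r ?addr0// => k /negPf ki.
by rewrite mxE ki mul0r.
Qed.

(** No pure row does better than the equilibrium value, which is a mean of the
    values of the pure rows with positive weights; so all rows give that value,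
    and its opposite solves the system that [lambda_star] chooses from. *)
Lemma lambda_starP N M (U : 'M[R]_(N, M)) p q : fully_mixed_nash U p q ->
  forall i, \sum_j U i j * q j 0 + lambda_star U q = 0.
Proof.
case=> -[[_ p1] _] [p0 _] pmin _.
apply: (@xgetPex _ 0 [set l | forall i, \sum_j U i j * q j 0 + l = 0]%classic).
exists (- payoff U p q) => i.
apply/eqP; rewrite subr_eq0; apply/eqP; rewrite payoff_rows.
apply: (mean_le_all_eq (w := fun i => p i 0)) => // k.
have := pmin _ (prob_vector_delta k).
by rewrite !payoff_rows sum_delta.
Qed.

Lemma mu_starP N M (U : 'M[R]_(N, M)) p q : fully_mixed_nash U p q ->
  forall j, \sum_i U i j * p i 0 + mu_star U p = 0.
Proof.
case=> -[_ [_ q1]] [_ q0] _ qmax.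
apply: (@xgetPex _ 0 [set m | forall j, \sum_i U i j * p i 0 + m = 0]%classic).
exists (- payoff U p q) => j.
apply/eqP; rewrite subr_eq0 -eqr_opp; apply/eqP; rewrite payoff_cols.
have sumN : - (\sum_k q k 0 * \sum_i U i k * p i 0) =
    \sum_k q k 0 * - \sum_i U i k * p i 0.
  by rewrite -sumrN; apply: eq_bigr => k _; rewrite mulrN.
rewrite sumN.
apply: (mean_le_all_eq (w := fun j => q j 0)
  (c := fun j => - \sum_i U i j * p i 0)) => // k.
rewrite -sumN lerN2.
have := qmax _ (prob_vector_delta k).
by rewrite !payoff_cols sum_delta.
Qed.

(** Pairing the gradient with the deviation [a - w] and expressing it through
    the deviation [b - v] leaves a bilinear form that is symmetric in the two
    players, plus a term that only sees the sum constraint. *)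
Lemma interaction_centered n m (V : 'I_n -> 'I_m -> R) (a w : 'I_n -> R)
    (b v : 'I_m -> R) (l lstar : R) :
  \sum_i w i = 1 -> (forall i, \sum_j V i j * v j + lstar = 0) ->
  \sum_i (a i - w i) * (\sum_j V i j * b j + l) =
  \sum_i \sum_j (a i - w i) * V i j * (b j - v j)
  + (l - lstar) * (\sum_i a i - 1).
Proof.
move=> w1 Vv; rewrite -w1 -sumrB mulr_sumr -big_split/=.
apply: eq_bigr => i _; under [in RHS]eq_bigr do rewrite -mulrA mulrBr.
rewrite -mulr_sumr sumrB [_ * (a i - _)]mulrC -mulrDr.
congr (_ * _); have := Vv i; lra.
Qed.

End Game.

(** * One step of the iteration *)

Section Step.
Variable R : realType.

Lemma H_half_squares N M (U : 'M[R]_(N, M)) p q (s : state R N M) :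
  H U p q s = \sum_i sigmoid_energy (p i 0) (theta s i 0)
    + \sum_j sigmoid_energy (q j 0) (phi s j 0)
    + (lambda s - lambda_star U q) ^+ 2 / 2 + (mu s - mu_star U p) ^+ 2 / 2.
Proof. by rewrite /H !oriented_integral_subr. Qed.

Lemma half_sqr_step (x l d : R) :
  (x - l) ^+ 2 / 2 + (x - l) * d <= (x + d - l) ^+ 2 / 2.
Proof. by have := sqr_ge0 d; lra. Qed.

Lemma ler_sum_increments (x1 x2 x3 x4 y1 y2 y3 y4 d1 d2 d3 d4 : R) :
  x1 + d1 <= y1 -> x2 + d2 <= y2 -> x3 + d3 <= y3 -> x4 + d4 <= y4 ->
  d1 + d2 + d3 + d4 = 0 -> x1 + x2 + x3 + x4 <= y1 + y2 + y3 + y4.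
Proof. lra. Qed.

(** [H] lies above its tangent at the current state, and the tangent does not
    vary in the direction of the update. *)
Lemma H_gda_step N M (U : 'M[R]_(N, M)) p q alpha (s : state R N M) :
  fully_mixed_nash U p q ->
  (forall i, p i 0 \in `]0, 1[) -> (forall j, q j 0 \in `]0, 1[) ->
  H U p q s <= H U p q (gda_step U alpha s).
Proof.
move=> hpq p01 q01; have lP := lambda_starP hpq; have mP := mu_starP hpq.
case: hpq => -[[_ p1] [_ q1]] _ _ _.
pose a i := sigmoid (theta s i 0); pose b j := sigmoid (phi s j 0).
pose row_grad i := \sum_j U i j * b j + lambda s.
pose col_grad j := \sum_i U i j * a i + mu s.
(* The row and column players see the same bilinear form with opposite signs;
   only the constraint terms survive, and the updates of lambda and mu absorb
   them. *)
have first_order : \sum_j (b j - q j 0) * col_grad j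
    - \sum_i (a i - p i 0) * row_grad i =
    (mu s - mu_star U p) * (\sum_j b j - 1)
    - (lambda s - lambda_star U q) * (\sum_i a i - 1).
  rewrite (interaction_centered a b (lambda s) p1 lP).
  rewrite (interaction_centered b a (mu s) q1 mP) exchange_big/=.
  under eq_bigr do under eq_bigr do rewrite mulrC mulrA [_ * (b _ - _)]mulrC.
  under [X in _ - (X + _)]eq_bigr do under eq_bigr do rewrite mulrC mulrA.
  lra.
have rows : \sum_i sigmoid_energy (p i 0) (theta s i 0)
    - alpha * \sum_i (a i - p i 0) * row_grad i
    <= \sum_i sigmoid_energy (p i 0) (theta (gda_step U alpha s) i 0).
  rewrite mulr_sumr -sumrB; apply: ler_sum => i _; rewrite mxE -/(row_grad i).
  set d := derive1 sigmoid (theta s i 0).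
  have -> : theta s i 0 - alpha * d * row_grad i
    = theta s i 0 + d * (- alpha * row_grad i) by ring.
  have -> : - (alpha * ((a i - p i 0) * row_grad i))
    = (a i - p i 0) * (- alpha * row_grad i) by ring.
  exact: sigmoid_energy_step.
have cols : \sum_j sigmoid_energy (q j 0) (phi s j 0)
    + alpha * \sum_j (b j - q j 0) * col_grad j
    <= \sum_j sigmoid_energy (q j 0) (phi (gda_step U alpha s) j 0).
  rewrite mulr_sumr -big_split; apply: ler_sum => j _; rewrite mxE -/(col_grad j).
  set d := derive1 sigmoid (phi s j 0).
  have -> : alpha * d * col_grad j = d * (alpha * col_grad j) by ring.
  rewrite mulrCA.
  exact: sigmoid_energy_step.
rewrite !H_half_squares.
apply: (ler_sum_increments rows cols (half_sqr_step _ _ _) (half_sqr_step _ _ _)).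
have -> (D1 D2 A B l m : R) : - (alpha * D1) + alpha * D2
    + (lambda s - l) * (alpha * A) + (mu s - m) * - (alpha * B)
  = alpha * (D2 - D1 - ((mu s - m) * B - (lambda s - l) * A)) by ring.
by rewrite first_order subrr mulr0.
Qed.

End Step.

Theorem theorem9 (R : realType) (N M : nat) (U : 'M[R]_(N, M))
  (p : 'cV[R]_N) (q : 'cV[R]_M) (hpq : fully_mixed_nash U p q)
  (alpha : R) (halpha : 0 < alpha)
  (s0 : state R N M) (hs0 : safe p q s0) (k : nat) :
  H U p q (iter k (gda_step U alpha) s0) <=
  H U p q (iter k.+1 (gda_step U alpha) s0).
Proof.
rewrite iterS; case: hs0 => hp hq.
have attained (x0 z : R) : safe_for sigmoid x0 z -> z \in `]0, 1[.
  by case=> _ [x [_ [t <-]]]; rewrite in_itv/= sigmoid_gt0 sigmoid_lt1.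
by apply: H_gda_step => // i; [exact: attained (hp i)|exact: attained (hq i)].
Qed.
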